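(* If the sequence $\big((3/2)^n\big)_{n\ge0}$ is dense modulo one, then $p_T(k)\ge\lceil(3/2)^k\rceil-1$ for every $k\in\mathbb{N}$.
   Context: For $n\in\mathbb{N}=\{0,1,2,\dots\}$ let $m_n\in\mathbb{Z}$ be the nearest integer to $(3/2)^n$, with half-integers rounded up, and let $\varepsilon_n=(3/2)^n-m_n\in[-\tfrac12,\tfrac12)$. The steering letter is $t_n=2m_{n+1}-3m_n\in\{-2,-1,0,1,2\}$, and the steering word is the infinite word $T=(t_n)_{n\ge0}$. The subword complexity $p_T(k)$ is the number of distinct length-$k$ factors of $T$, i.e. the number of distinct blocks $(t_a,t_{a+1},\dots,t_{a+k-1})$ with $a\in\mathbb{N}$. Dense modulo one means that the set $\{\varepsilon_n: n\in\mathbb{N}\}$ is dense in $[-\tfrac12,\tfrac12)$ (equivalently, the image of the sequence in $\mathbb{R}/\mathbb{Z}$ is dense). *)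

(* Defs.v *)
From mathcomp Require Import all_boot all_order all_algebra finmap.
From mathcomp Require Import zify lra.
From mathcomp Require Import boolp classical_sets functions cardinality.
From mathcomp Require Import set_interval reals topology normedtype.

Set Implicit Arguments.
Unset Strict Implicit.
Unset Printing Implicit Defensive.

Import Order.TTheory GRing.Theory Num.Theory.
Import numFieldNormedType.Exports.

Local Open Scope classical_set_scope.
Local Open Scope ring_scope.

(* Nearest integer, half-integers rounded up. *)
Definition nearest_int (R : realType) (x : R) : int := Num.floor (x + 1 / 2).

Section Steering.
Variable R : realType.

Definition m_ (n : nat) : int := nearest_int ((3 / 2 : R) ^+ n).

Definition eps_ (n : nat) : R := (3 / 2) ^+ n - (m_ n)%:~R.

Definition steering_word (n : nat) : int := 2 * m_ n.+1 - 3 * m_ n.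

Definition three_halves_dense_mod_one : Prop :=
  `[- (1 / 2) : R, 1 / 2[ `<=` closure (range eps_).

End Steering.

Section Complexity.
Variable A : choiceType.

(* The block (u a, ..., u (a + k - 1)). *)
Definition factor (u : nat -> A) (k a : nat) : k.-tuple A :=
  [tuple u (a + i)%N | i < k].

(* [fset_set] is the empty set on an infinite set; see
   [finite_steering_factors] for the word of interest. *)
Definition subword_complexity (u : nat -> A) (k : nat) : nat :=
  #|` fset_set (range (factor u k)) |.

End Complexity.

Lemma eps_itv (R : realType) n : - (1 / 2) <= eps_ R n < 1 / 2.
Proof.
rewrite /eps_ /m_ /nearest_int.
have := floor_itv ((3 / 2 : R) ^+ n + 1 / 2); rewrite intrD => /andP[h1 h2].
by apply/andP; split; lra.
Qed.

Lemma steering_word_itv (R : realType) n : -2 <= steering_word R n <= 2.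
Proof.
have /andP[a1 a2] := eps_itv R n; have /andP[b1 b2] := eps_itv R n.+1.
have E : (steering_word R n)%:~R = 3 * eps_ R n - 2 * eps_ R n.+1.
  by rewrite /steering_word /eps_ intrB !intrM exprS; lra.
have : (-3 : int)%:~R < (steering_word R n)%:~R :> R by rewrite E; lra.
have : (steering_word R n)%:~R < (3 : int)%:~R :> R by rewrite E; lra.
by rewrite !ltr_int; lia.
Qed.

Lemma finite_steering_factors (R : realType) k :
  finite_set (range (factor (steering_word R) k)).
Proof.
pose g (w : k.-tuple 'I_5) : k.-tuple int := [tuple (tnth w i)%:Z - 2 | i < k].
apply: (@sub_finite_set _ _ (range g)); last exact/finite_image/finite_finset.
move=> _ [a _ <-].
exists [tuple inord (absz (steering_word R (a + i) + 2)) | i < k] => //.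
apply: eq_from_tnth => i; rewrite !tnth_mktuple.
have := steering_word_itv R (a + i) => /andP[h1 h2].
by rewrite inordK; lia.
Qed.

(* Main.v *)
Require Import Defs.
From mathcomp Require Import all_boot all_order all_algebra finmap.
From mathcomp Require Import lra.
From mathcomp Require Import boolp classical_sets functions cardinality.
From mathcomp Require Import set_interval reals topology normedtype.

Import Order.TTheory GRing.Theory Num.Theory.
Import numFieldNormedType.Exports.

Local Open Scope classical_set_scope.
Local Open Scope ring_scope.

(** The recursion [eps_ n = (t_n + 2 eps_ (n + 1)) / 3] determines [eps_ n] from
    the block [t_n, ..., t_(n+k-1)] up to [(2/3)^k eps_ (n + k)], so indices
    carrying the same block of length [k] have their [eps_] less than [(2/3)^k]
    apart.  If [N < (3/2)^k], the points [j / N - 1/2] with [j < N] are more than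
    [(2/3)^k] apart; by density they are approximated by values of [eps_], whose
    blocks of length [k] are then pairwise distinct. *)

Lemma steering_wordE (R : realType) (n : nat) :
  (steering_word R n)%:~R = 3 * eps_ R n - 2 * eps_ R n.+1.
Proof. by rewrite /steering_word /eps_ intrB !intrM exprS; lra. Qed.

Lemma eq_steering_sub_eps (R : realType) (k a b : nat) :
  (forall i, (i < k)%N ->
    steering_word R (a + i) = steering_word R (b + i)) ->
  eps_ R a - eps_ R b = (2 / 3) ^+ k * (eps_ R (a + k) - eps_ R (b + k)).
Proof.
elim: k => [|k IHk] eq_ab; first by rewrite !addn0 expr0 mul1r.
rewrite IHk => [|i lt_ik]; last by apply: eq_ab; rewrite ltnS ltnW.
rewrite exprSr -mulrA; congr (_ * _).
(* The two blocks share their letter at position [k], so it cancels when the recursions at [a + k]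
   and [b + k] are subtracted. *)
have := congr1 (fun t : int => t%:~R : R) (eq_ab k (ltnSn k)).
by rewrite /= !steering_wordE -!addnS; lra.
Qed.

Lemma eq_factor_dist_eps (R : realType) (k a b : nat) :
  Defs.factor (steering_word R) k a = Defs.factor (steering_word R) k b ->
  `|eps_ R a - eps_ R b| < (2 / 3) ^+ k.
Proof.
move=> eq_ab; rewrite (@eq_steering_sub_eps _ k) => [|i lt_ik].
  have r_gt0 : 0 < (2 / 3 : R) ^+ k by apply: exprn_gt0; lra.
  (* Strict, because both remaining values lie in one half-open interval of length 1. *)
  rewrite normrM gtr0_norm // gtr_pMr // ltr_norml.
  have /andP[? ?] := eps_itv R (a + k).
  by have /andP[? ?] := eps_itv R (b + k); apply/andP; split; lra.
by have := congr1 (fun w => tnth w (Ordinal lt_ik)) eq_ab; rewrite !tnth_mktuple.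
Qed.

Lemma dense_eps_approx (R : realType) (x d : R) :
  three_halves_dense_mod_one R -> - (1 / 2) <= x < 1 / 2 -> 0 < d ->
  exists n, `|x - eps_ R n| < d.
Proof.
move=> dense_eps x_itv d_gt0.
have /dense_eps /(_ _ (nbhsx_ballx x d d_gt0)) [_ [[n _ <-]]] :
  `[- (1 / 2) : R, 1 / 2[%classic x by rewrite /= in_itv.
by rewrite -ball_normE; exists n.
Qed.

(** Finiteness keeps [fset_set] from defaulting to the empty set, so the [N] distinct factors are
    really counted. *)
Lemma subword_complexity_ge (A : choiceType) (u : nat -> A) (k N : nat)
    (a : 'I_N -> nat) :
  finite_set (range (Defs.factor u k)) -> injective (Defs.factor u k \o a) ->
  (N <= subword_complexity u k)%N.
Proof.
move=> fin_u inj_a; have : #|` [fset (Defs.factor u k \o a) i | i : 'I_N]%fset| = N.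
  by rewrite card_imfset //= size_enum_ord.
move=> <-; apply: fsubset_leq_card; apply/fsubsetP => _ /imfsetP[i _ ->].
by rewrite in_fset_set // inE; exists (a i).
Qed.

Lemma steering_complexity_ge (R : realType) (k N : nat) :
  three_halves_dense_mod_one R -> N%:R < (3 / 2 : R) ^+ k ->
  (N <= subword_complexity (steering_word R) k)%N.
Proof.
move=> dense_eps ltN.
have [->//|N_gt0] := posnP N.
have NR_gt0 : 0 < N%:R :> R by rewrite ltr0n.
(* Half the excess of the grid spacing [1 / N] over [(2 / 3) ^+ k], to be spent on two approximation
   errors. *)
pose d : R := (N%:R^-1 - (2 / 3) ^+ k) / 2.
have d_gt0 : 0 < d.
  rewrite divr_gt0 // subr_gt0 -[2 / 3]invf_div exprVn ltf_pV2 ?posrE //.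
  by apply: exprn_gt0; lra.
pose x (j : 'I_N) : R := j%:R / N%:R - 1 / 2.
have /choice[a aP] (j : 'I_N) : exists n, `|x j - eps_ R n| < d.
  apply: dense_eps_approx => //; rewrite /x.
  have : 0 <= j%:R / N%:R :> R by rewrite divr_ge0.
  have : j%:R / N%:R < 1 :> R by rewrite ltr_pdivrMr // mul1r ltr_nat.
  by move=> ? ?; apply/andP; split; lra.
apply: (subword_complexity_ge _ _ _ _ a); first exact: finite_steering_factors.
have sep (i j : 'I_N) : (i < j)%N ->
    Defs.factor (steering_word R) k (a i) <> Defs.factor (steering_word R) k (a j).
  move=> lt_ij /eq_factor_dist_eps; rewrite ltr_norml => /andP[eps_ij _].
  have : N%:R^-1 <= x j - x i.
    have : (i%:R + 1) / N%:R <= j%:R / N%:R :> R.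
      by rewrite ler_pM2r ?invr_gt0 // natr1 ler_nat.
    by rewrite /x mulrDl mul1r; lra.
  (* Equal blocks would give [x j - x i < (2 / 3) ^+ k + 2 * d], which is exactly [1 / N]. *)
  move: (aP i) (aP j); rewrite !ltr_norml /d => /andP[? ?] /andP[? ?].
  by lra.
move=> i j /= eq_ij; apply/val_inj; case: (ltngtP i j) => // lt_ij.
  by case: (sep _ _ lt_ij).
by case: (sep _ _ lt_ij).
Qed.

Theorem corollary1p3 (R : realType)
    (dense_eps : three_halves_dense_mod_one R) (k : nat) :
  Num.ceil ((3 / 2 : R) ^+ k) - 1
    <= (subword_complexity (steering_word R) k)%:Z.
Proof.
have /andP[+ _] := ceil_itv ((3 / 2 : R) ^+ k).
(* The ceiling minus one is strictly below the power, as the grid argument requires; a negative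
   value is trivially a lower bound. *)
case: (Num.ceil _ - 1) => [N|//] ltN.
by rewrite lez_nat; apply: steering_complexity_ge.
Qed.
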